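(* Let $X$ be a countably infinite set and let $\mathcal{H}\subseteq 2^X$ be a VC infinite hypothesis. Then for every $m\in\omega$ there exists a sample $f_m:\omega\to X$ such that for all $k<m$, $$S(\mathcal{H},f_m,k)=0 .$$
   Context: $2^X$ is the set of functions $X\to\{0,1\}$; a hypothesis is a subset $\mathcal{H}\subseteq 2^X$. For $X_0\subseteq X$, $\mathcal{H}{\upharpoonright}_{X_0}=\{h{\upharpoonright}_{X_0}: h\in\mathcal{H}\}$; $\mathcal{H}$ shatters $X_0$ if $\mathcal{H}{\upharpoonright}_{X_0}=2^{X_0}$. $\mathcal{H}$ is VC finite if there is $d\in\omega$ such that every set shattered by $\mathcal{H}$ has at most $d$ elements, and VC infinite otherwise (i.e. it shatters arbitrarily large finite sets). A sample of $X$ is an injective function $f:\omega\to X$. Write $[n]=\{0,\dots,n-1\}$. The surprise of $\mathcal{H}$ along $f$ at stage $n$ is $$S(\mathcal{H},f,n)=1-\frac{|\mathcal{H}{\upharpoonright}_{f([n])}|}{2^{|f([n])|}}.$$ *)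

(* Defs.v *)
From mathcomp Require Import all_boot all_order all_algebra finmap.
From mathcomp Require Import boolp classical_sets functions cardinality.
Set Implicit Arguments.
Unset Strict Implicit.
Unset Printing Implicit Defensive.
Import GRing.Theory.
Local Open Scope ring_scope.
Local Open Scope classical_set_scope.
Local Open Scope card_scope.

Definition restriction (X : Type) (H : set (X -> bool)) (X0 : set X) :
  set (X0 -> bool) := [set sigL X0 h | h in H].
Arguments restriction {X} H X0.

Definition shatters (X : Type) (H : set (X -> bool)) (X0 : set X) : Prop :=
  restriction H X0 = [set: X0 -> bool].

Definition VC_finite (X : Type) (H : set (X -> bool)) : Prop :=
  exists d : nat, forall X0 : set X, shatters H X0 -> X0 #<= `I_d.

Definition VC_infinite (X : Type) (H : set (X -> bool)) : Prop :=
  ~ VC_finite H.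

Definition sample (X : Type) (f : nat -> X) : Prop := injective f.

(* fset_set returns the empty finite set on an infinite argument; both sets
   counted here are finite since f @` `I_n is. *)
Definition surprise (X : choiceType) (H : set (X -> bool)) (f : nat -> X)
    (n : nat) : rat :=
  1 - #|` fset_set (restriction H (f @` `I_n))|%:R
      / 2%:R ^+ #|` fset_set (f @` `I_n)|.

(* Main.v *)
Require Import Defs.
From mathcomp Require Import all_boot all_order all_algebra finmap.
From mathcomp Require Import boolp classical_sets functions cardinality.
Set Implicit Arguments.
Unset Strict Implicit.
Unset Printing Implicit Defensive.
Import GRing.Theory Num.Theory.
Local Open Scope ring_scope.
Local Open Scope classical_set_scope.
Local Open Scope card_scope.

(** A VC infinite class shatters some set [A] that does not have at most [m]
    elements. Any injective sequence whose first [m] values lie in [A] is then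
    a sample with the required property: for [k < m] the set [f @` `I_k] is a
    subset of [A], subsets of shattered sets are shattered, and a shattered
    finite set with [d] elements carries all [2 ^ d] traces, so that the
    surprise there is [1 - 2 ^ d / 2 ^ d = 0].

    Such a sequence exists by [injective_prefix], which is where the
    infiniteness of [X] enters: [m] points of [A] leave infinitely many points
    of [X] available for the tail. The counting is [card_boolfun], and
    [surprise_eq0] draws the consequence for the surprise. *)

(** Cardinal comparison is defined through injections between subtypes; a
    default point [x0] extends such an injection to a function on the whole of
    [T], also when [U] carries no canonical point. *)
Lemma card_le_ex_inj (T U : Type) (x0 : U) (A : set T) (B : set U) :
  A #<= B -> exists2 f : T -> U, set_fun A B f & set_inj A f.
Proof. by move=> /card_leP[f]; apply/injfunPex; squash (valLR x0 f). Qed.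

(** Comparability with an initial segment of the integers: a finite [A] reduces
    to the order of [nat], and an infinite one contains a copy of [nat]. *)
Lemma II_le_of_not_le_II (T : Type) (A : set T) (m : nat) :
  ~ (A #<= `I_m) -> `I_m #<= A.
Proof.
move=> nAm; have [[n An]|/infiniteP natA] := pselect (finite_set A).
  move: nAm; rewrite (card_le_eql An) (card_le_eqr An) !card_le_II.
  by case: (leqP n m) => // /ltnW.
exact: card_le_trans (card_leT _) natA.
Qed.

(** Removing finitely many points from an infinite type leaves room for an
    injective sequence. An injection of [`I_m] into [A] therefore extends to
    all of [nat]: the tail is taken outside the values already used. *)
Lemma injective_prefix (X : Type) (A : set X) (m : nat) :
    infinite_set [set: X] -> `I_m #<= A ->
  exists2 f : nat -> X, injective f & f @` `I_m `<=` A.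
Proof.
move=> Xinf mA; have [x0 _] := infinite_setN0 Xinf.
have [g gA ginj] := card_le_ex_inj x0 mA.
have gfin : finite_set (g @` `I_m) by apply/finite_image/finite_II.
have /infiniteP/(card_le_ex_inj x0)[h hC hinj] := infinite_setD Xinf gfin.
have gh i j : (i < m)%N -> g i <> h j.
  by move=> im gihj; case: (hC j I) => _; apply; exists i.
exists (fun i => if (i < m)%N then g i else h i); last first.
  by move=> _ [i /= im <-]; rewrite im; apply: gA.
move=> i j; case: ifPn => im; case: ifPn => jm.
- by apply: ginj; rewrite inE.
- by move/gh => /(_ im).
- by move/esym/gh => /(_ jm).
- by apply: hinj; rewrite inE.
Qed.

(** A pattern on [A] extends by [false] to a pattern on [B], and a member of [H]
    that realizes the extension realizes the original pattern. *)
Lemma shatters_subset (X : Type) (H : set (X -> bool)) (A B : set X) :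
  A `<=` B -> shatters H B -> shatters H A.
Proof.
move=> AB HB; apply/seteqP; split=> // p _.
have : restriction H B (sigL B (valL_ false p)) by rewrite HB.
case=> h Hh hB; exists h => //; rewrite -[p in RHS](valLK false).
apply/eq_sigLP => x Ax; move/eq_sigLP: hB; apply.
by rewrite !inE in Ax *; exact: AB.
Qed.

Lemma card_setT_finType (T : finType) : [set: T] #= `I_#|T|.
Proof.
rewrite (card_eqr card_II); apply/card_eqP.
by squash (to_setT \o enum_rank \o set_val).
Qed.

(** A numbering of [A] transports [{ffun 'I_n -> bool}], whose cardinal is
    [2 ^ n], bijectively onto the functions on [A]. *)
Lemma card_boolfun (T : Type) (A : set T) (n : nat) :
  A #= `I_n -> [set: A -> bool] #= `I_(2 ^ n).
Proof.
rewrite (card_eqr card_II) => /card_bijP[e [e' eK e'K]].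
pose F (p : {ffun 'I_n -> bool}) (a : A) := p (val (e a)).
have Finj : injective F.
  move=> p q Fpq; apply/ffunP => i.
  by have := congr1 (fun u => u (e' (to_setT i))) Fpq; rewrite /F e'K.
have <- : F @` [set: {ffun 'I_n -> bool}] = [set: A -> bool].
  apply/seteqP; split=> // u _.
  exists [ffun i => u (e' (to_setT i))] => //; apply/funext => a.
  rewrite /F ffunE; congr u; rewrite -[RHS]eK; congr e'; exact: val_inj.
apply: card_eq_trans (inj_card_eq _) _; first by move=> p q _ _; exact: Finj.
rewrite -[n in (2 ^ n)%N]card_ord -card_bool -card_ffun.
exact: card_setT_finType.
Qed.

Lemma surprise_eq0 (X : choiceType) (H : set (X -> bool)) (f : nat -> X)
    (n : nat) : shatters H (f @` `I_n) -> surprise H f n = 0.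
Proof.
move=> Hn; have [d fd] : finite_set (f @` `I_n).
  exact/finite_image/finite_II.
rewrite /surprise Hn (card_fset_set fd) (card_fset_set (card_boolfun fd)).
by rewrite natrX divff ?subrr// expf_neq0// pnatr_eq0.
Qed.

Theorem theorem1p1 (X : choiceType) (H : set (X -> bool))
    (X_countably_infinite : [set: X] #= [set: nat])
    (H_VC_infinite : VC_infinite H) (m : nat) :
  exists f : nat -> X, sample f /\
    forall k : nat, (k < m)%N -> surprise H f k = 0.
Proof.
have Xinf : infinite_set [set: X].
  by apply/infiniteP; rewrite (card_le_eqr X_countably_infinite).
have [A HA mA] : exists2 A, shatters H A & `I_m #<= A.
  apply: contra_notP H_VC_infinite => noA; exists m => A HA.
  by apply: contra_notP noA => nAm; exists A => //; exact: II_le_of_not_le_II.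
have [f finj fA] := injective_prefix Xinf mA.
exists f; split=> // k km; apply/surprise_eq0/(shatters_subset _ HA).
by move=> x [i /= ik <-]; apply: fA; exists i => //=; exact: ltn_trans km.
Qed.
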